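(* Let $n,r\ge1$ be integers. The free $\mathbb{Z}$-module $G(n,r)$ with the bilinear product $\star$ is an (associative) $\mathbb{Z}$-algebra.
   Context: Let $k$ be an algebraically closed field, $V$ an $r$-dimensional $k$-space, $\mathcal{F}$ the variety of $n$-step flags $f:\{0\}=V_0\subseteq V_1\subseteq\cdots\subseteq V_n=V$. $\mathrm{GL}(V)$ acts on $\mathcal{F}$ and diagonally on $\mathcal{F}\times\mathcal{F}$; the orbits in $\mathcal{F}\times\mathcal{F}$ are in bijection with $n\times n$ matrices of non-negative integers with entries summing to $r$ via $A(f,f')_{ij}=\dim(V_{i-1}+V_i\cap V'_j)-\dim(V_{i-1}+V_i\cap V'_{j-1})$, for $f=(V_i)$, $f'=(V'_i)$; $e_A$ is the orbit with matrix $A$. For orbits $e_A,e_{A'}$ let $S(A,A')=\{(f_1,f_2)\in\mathcal{F}\times\mathcal{F}: \exists f\in\mathcal{F},\ (f_1,f)\in e_A,\ (f,f_2)\in e_{A'}\}$. If $S(A,A')$ is non-empty, it contains a unique $\mathrm{GL}(V)$-orbit that is open in it (Zariski topology). $G(n,r)$ is the free $\mathbb{Z}$-module with basis the set of $\mathrm{GL}(V)$-orbits in $\mathcal{F}\times\mathcal{F}$; the product is $e_A\star e_{A'}=e_{A''}$ if $S(A,A')$ is non-empty and $e_{A''}$ is the open orbit in $S(A,A')$, and $e_A\star e_{A'}=0$ if $S(A,A')$ is empty, extended bilinearly. *)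

(* Defs.v *)
From HB Require Import structures.
From mathcomp Require Import all_boot all_order all_algebra.
From mathcomp Require Import boolp classical_sets.
From mathcomp Require Import mpoly freeg.

Set Implicit Arguments.
Unset Strict Implicit.
Unset Printing Implicit Defensive.

Import GRing.Theory.

Local Open Scope classical_set_scope.
Local Open Scope ring_scope.

Section Flags.
Variables (k : closedFieldType) (V : vectType k) (n : nat).

Definition is_flag (f : {ffun 'I_n.+1 -> {vspace V}}) : bool :=
  [&& f ord0 == 0%VS, f ord_max == fullv
    & [forall i : 'I_n, (f (widen_ord (leqnSn n) i) <= f (fintype.lift ord0 i))%VS]].

Record flag := Flag {
  flag_val :> {ffun 'I_n.+1 -> {vspace V}};
  flagP : is_flag flag_val }.

Definition flag_pair : Type := (flag * flag)%type.

(** [GL(V)] consists of the [g : 'End(V)] with trivial kernel; [V] being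
    finite dimensional, these are exactly the automorphisms of [V]. *)
Definition moves (g : 'End(V)) (f f' : flag) : Prop :=
  forall i, f' i = (g @: f i)%VS.

Definition same_orbit (x y : flag_pair) : Prop :=
  exists g : 'End(V), [/\ lker g == 0%VS, moves g x.1 y.1 & moves g x.2 y.2].

Definition is_orbit (O : set flag_pair) : Prop :=
  exists x, O = [set y | same_orbit x y].

Definition orbit : choiceType := {O : set flag_pair | `[< is_orbit O >]}.

Definition composites (O O' : orbit) : set flag_pair :=
  [set x | exists f : flag, val O (x.1, f) /\ val O' (f, x.2)].

(** Zariski topology on pairs of flags.  A subspace [U] of dimension [d] is sent
    to the point of P(/\V), with /\V the whole exterior algebra, given by its
    maximal minors in a fixed basis of [V]: the coordinate indexed by a set [I]
    of basis vectors is the minor with columns [I] if [#|I| = d], and 0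
    otherwise.  On subspaces of dimension [d] this is the Pluecker embedding into
    P(/\^d V); different dimensions land in disjoint closed linear subspaces, so
    the induced topology is that of the disjoint union of the Grassmannians. *)
Definition plucker (U : {vspace V}) (I : {set 'I_(\dim {:V})}) : k :=
  if #|I| == \dim U then
    \det (\matrix_(i < #|I|, j < #|I|)
            coord (vbasis {:V}) (enum_val j) (vbasis U)`_i)
  else 0.

(** The factors of the product of projective spaces in which pairs of flags are
    embedded: [(false, i)] and [(true, i)] stand for the [i]-th subspace of the
    first and of the second flag. *)
Definition factor : finType := (bool * 'I_n.+1)%type.

Definition factor_space (x : flag_pair) (a : factor) : {vspace V} :=
  if a.1 then x.2 a.2 else x.1 a.2.

Definition coord_index : finType := (factor * {set 'I_(\dim {:V})})%type.

(** [p] vanishes at a point of the product of projective spaces when it vanishes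
    on every choice of homogeneous coordinates, rescaled independently in each
    factor.  As [k] is infinite, this means that every multihomogeneous
    component of [p] vanishes there. *)
Definition vanishes (p : {mpoly k[#|coord_index|]}) (x : flag_pair) : Prop :=
  forall c : factor -> k, (forall a, c a != 0) ->
    p.@[fun t => let aI : coord_index := enum_val t in
                 c aI.1 * plucker (factor_space x aI.1) aI.2] = 0.

Definition zariski_closed (Z : set flag_pair) : Prop :=
  exists P : set {mpoly k[#|coord_index|]},
    Z = [set x | forall p, P p -> vanishes p x].

Definition zariski_open_in (S U : set flag_pair) : Prop :=
  exists2 Z, zariski_closed Z & U = S `\` Z.

Definition is_open_orbit (S : set flag_pair) (O : orbit) : Prop :=
  val O `<=` S /\ zariski_open_in S (val O).

(** The free Z-module on the set of orbits. *)
Definition G : lmodType int := {freeg orbit / int}.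

(** An empty [composites O O'] contains no orbit, since orbits are non-empty; a
    non-empty one contains exactly one open orbit.  So the [else] branch is the
    case where [composites O O'] is empty. *)
Definition star_basis (O O' : orbit) : G :=
  if pselect (exists O'', is_open_orbit (composites O O') O'') is left h
  then << projT1 (cid h) >> else 0.

Definition star (x y : G) : G :=
  fglift (fun O => fglift (fun O' => star_basis O O') y) x.

End Flags.

Definition is_assoc_Zalgebra (M : lmodType int) (mul : M -> M -> M) : Prop :=
  [/\ forall a x y z, mul (a *: x + y) z = a *: mul x z + mul y z,
      forall a x y z, mul z (a *: x + y) = a *: mul z x + mul z y,
      associative mul
    & exists e, left_id e mul /\ right_id e mul].

(* Main.v *)
Require Import Defs.
From mathcomp Require Import all_boot all_order all_algebra.
From mathcomp Require Import boolp classical_sets.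
From mathcomp Require Import mpoly freeg.

(** Write [S] for the set [composites O O'] of composites of two orbits.  An
    orbit of pairs of flags is determined by the dimensions
    [\dim (x.1 i :&: x.2 j)] ([same_orbitP], which rests on the construction of
    an isomorphism between two pairs of filtrations in [filtrations_conj]).

    Irreducibility of [S] is used in an elementary form.  Up to [GL(V)], two
    points of [S] have the same first flag and the same middle flag [f], and
    their last flags differ by an automorphism [s] stabilising [f]
    ([composites_connected]).  The endomorphisms stabilising [f] form a linear
    space, so the line [1 + t (s - 1)] moves one point to the other inside [S],
    finitely many [t] excepted.  Along this line the dimensions of intersections
    with a fixed subspace are, for all but finitely many [t], at most what they
    are at any given invertible parameter, since the ranks involved are witnessed
    by minors that are polynomials in [t].  Finitely many such requirements can
    be met by one [t].

    Consequently [S], if non-empty, contains points at which all the dimensions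
    are minimal at once ([minimal_ex]), and they form one orbit.  This orbit is
    open, because bounding the dimension of the sum of two subspaces from below
    is an open condition in Pluecker coordinates ([dim_polys]); and it is the
    only open one, because a line joining an open orbit to it meets both
    ([open_orbit_minimal]).  So the product of [O] and [O'] is the orbit of the
    minimal points of [S].

    For associativity, consider the pairs [(f1, f4)] that admit a chain
    [(f1, f2, f3, f4)] of pairs in [O1], [O2], [O3].  Moving the end of a chain
    along a line in the stabiliser of [f2] makes [(f1, f3)] generic without
    increasing the dimensions for [(f1, f4)]; a line in the stabiliser of [f3]
    does the same for [(f2, f4)].  Hence both bracketings give the orbit of the
    minimal points of this set of pairs, or [0] if it is empty ([star_basisA]).
    The unit is the sum of the orbits of the pairs [(f, f)], one for each
    possible sequence of dimensions of a flag. *)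

Set Implicit Arguments.
Unset Strict Implicit.
Unset Printing Implicit Defensive.

Import GRing.Theory passmx.
Local Open Scope ring_scope.

(** * Rank and general parameters of a line *)

Section Rank.
Variable k : fieldType.

(** Multiplying by arbitrary constant matrices on both sides replaces the choice
    of rows and columns of a minor, and keeps the witness a polynomial in the
    entries of [A]. *)
Lemma rank_minorP (m p q : nat) (A : 'M[k]_(m, p)) :
  reflect (exists L : 'M[k]_(q, m), exists R : 'M[k]_(p, q),
             \det (L *m A *m R) != 0)
    (q <= \rank A)%N.
Proof.
apply: (iffP idP) => [le_q | [L [R U]]].
  exists (pid_mx q *m invmx (col_ebase A)), (invmx (row_ebase A) *m pid_mx q).
  have le_qm : (q <= m)%N := leq_trans le_q (rank_leq_row A).
  have le_qp : (q <= p)%N := leq_trans le_q (rank_leq_col A).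
  rewrite -[X in _ *m X *m _](mulmx_ebase A) !mulmxA.
  rewrite mulmxKV ?col_ebase_unit //.
  rewrite mulmxK ?row_ebase_unit // !mul_pid_mx.
  rewrite (minn_idPl le_q) (minn_idPr le_qm) minnn.
  by rewrite (minn_idPr le_qp) pid_mx_1 det1 oner_neq0.
rewrite -unitfE in U; rewrite -(mxrank_unit (U : L *m A *m R \in unitmx)).
exact: leq_trans (mxrankM_maxl _ _) (mxrankM_maxr _ _).
Qed.

End Rank.

Section Generically.
Variable k : closedFieldType.

(** Cofiniteness on the affine line, with the finite exceptional set given by the
    roots of a nonzero polynomial: conjunction is then a product. *)
Definition generically (Q : k -> Prop) :=
  exists2 q : {poly k}, q != 0 & forall t, q.[t] != 0 -> Q t.

Lemma generically_ex Q : generically Q -> exists t, Q t.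
Proof.
by case=> q /closed_nonrootP[t qt] Qq; exists t; apply: Qq.
Qed.

Lemma generically_and Q Q' :
  generically Q -> generically Q' -> generically (fun t => Q t /\ Q' t).
Proof.
case=> q q0 Qq [q' q'0 Qq']; exists (q * q'); first by rewrite mulf_neq0.
by move=> t; rewrite hornerM mulf_eq0 negb_or => /andP[/Qq ? /Qq' ?].
Qed.

Lemma generically_imp (Q Q' : k -> Prop) :
  (forall t, Q t -> Q' t) -> generically Q -> generically Q'.
Proof. by move=> QQ' [q q0 Qq]; exists q => // t /Qq/QQ'. Qed.

Lemma generically_all (I : eqType) (r : seq I) (Q : I -> k -> Prop) :
  (forall i, generically (Q i)) ->
  generically (fun t => forall i, i \in r -> Q i t).
Proof.
move=> Qi; elim: r => [|i r IH]; first by exists 1; rewrite ?oner_neq0.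
apply: generically_imp (generically_and (Qi i) IH) => t [Qt Qr] j.
by rewrite inE => /orP[/eqP->|/Qr].
Qed.

Lemma horner_eval_polyC (m p : nat) (M : 'M[k]_(m, p)) t :
  map_mx (horner_eval t) (map_mx polyC M) = M.
Proof. by apply/matrixP => i j; rewrite !mxE /= /horner_eval hornerC. Qed.

(** Rank is lower semicontinuous: a minor that is nonzero at [t0] is a nonzero
    polynomial in [t]. *)
Lemma generically_rank (m p : nat) (A : 'M[{poly k}]_(m, p)) (t0 : k) :
  generically (fun t => (\rank (map_mx (horner_eval t0) A)
                         <= \rank (map_mx (horner_eval t) A))%N).
Proof.
have /rank_minorP[L [R LR]] := leqnn (\rank (map_mx (horner_eval t0) A)).
have ev t : (\det (map_mx polyC L *m A *m map_mx polyC R)).[t] =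
            \det (L *m map_mx (horner_eval t) A *m R).
  by rewrite -[LHS]/(horner_eval t _) -det_map_mx !map_mxM !horner_eval_polyC.
exists (\det (map_mx polyC L *m A *m map_mx polyC R)).
  by apply: contraNneq LR => D0; rewrite -ev D0 horner0.
by move=> t; rewrite ev => D; apply/rank_minorP; exists L, R.
Qed.

End Generically.

(** * Subspaces as row spaces, and lines in the endomorphism algebra *)

Section Coordinates.
Variables (k : fieldType) (V : vectType k).
Local Notation N := (\dim {:V}).
Local Notation B := (vbasis {:V}).
Implicit Types (U W : {vspace V}) (g : 'End(V)).

Definition basis_mx U : 'M[k]_(\dim U, N) := \matrix_(i, j) coord B j (vbasis U)`_i.

Lemma vbasisF : basis_of {:V} B. Proof. exact: vbasisP. Qed.

Lemma mem_basis_mx U v : (rVof B v <= basis_mx U)%MS = (v \in U).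
Proof.
have rE i : row i (basis_mx U) = rVof B (vbasis U)`_i.
  by apply/rowP=> j; rewrite !mxE.
apply/submxP/idP => [[c Ec]|/coord_vbasis Uv].
  rewrite -(rVofK vbasisF v) Ec mulmx_sum_row linear_sum memv_suml // => i _.
  rewrite linearZ rE /= rVofK ?vbasisF // memvZ // vbasis_mem //.
  by rewrite mem_nth // size_tuple.
exists (\row_i coord (vbasis U) i v).
rewrite mulmx_sum_row {1}Uv linear_sum; apply: eq_bigr => i _.
by rewrite linearZ rE mxE.
Qed.

(** A matrix may replace [basis_mx U] in any rank computation as soon as its rows
    span the coordinate vectors of [U]. *)
Lemma basis_mx_eq U m (A : 'M[k]_(m, N)) :
  (forall v, (rVof B v <= A)%MS = (v \in U)) -> (A :=: basis_mx U)%MS.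
Proof.
move=> AU; apply/eqmxP/andP; split; apply/rV_subP=> u.
  by rewrite -(vecofK vbasisF u) AU mem_basis_mx.
by rewrite -(vecofK vbasisF u) AU mem_basis_mx.
Qed.

Lemma rank_basis_mx U : \rank (basis_mx U) = \dim U.
Proof.
apply/eqP/row_freeP; exists (\matrix_(i, j) coord (vbasis U) j B`_i).
apply/matrixP=> i j; rewrite !mxE.
transitivity (coord (vbasis U) j (vbasis U)`_i).
  rewrite [X in _ = coord _ _ X](coord_vbasis (memvf _)) linear_sum.
  by apply: eq_bigr => l _; rewrite !mxE linearZ.
by rewrite coord_free ?(basis_free (vbasisP U)) // eq_sym.
Qed.

Lemma basis_mxD U W : (basis_mx (U + W)%VS :=: basis_mx U + basis_mx W)%MS.
Proof.
apply: eqmx_sym; apply: basis_mx_eq => v; apply/idP/idP => [/sub_addsmxP[[a b] /= E]|].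
  rewrite -(rVofK vbasisF v) E linearD /= memv_add // -mem_basis_mx.
    by rewrite vecofK ?vbasisF // submxMl.
  by rewrite vecofK ?vbasisF // submxMl.
move=> /memv_addP[u Uu [w Ww ->]]; rewrite linearD /=.
by apply: addmx_sub_adds; rewrite mem_basis_mx.
Qed.

Lemma basis_mx_img g U : (basis_mx (g @: U)%VS :=: basis_mx U *m mxof B B g)%MS.
Proof.
apply: eqmx_sym; apply: basis_mx_eq => v; apply/submxP/memv_imgP => [[c E]|[u Uu ->]].
  exists (vecof B (c *m basis_mx U)).
    by rewrite -mem_basis_mx vecofK ?vbasisF // submxMl.
  apply: (can_inj (rVofK vbasisF)).
  by rewrite E (rVof_app _ vbasisF) vecofK ?vbasisF // mulmxA.
move: Uu; rewrite -mem_basis_mx => /submxP[c Ec].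
by exists c; rewrite (rVof_app _ vbasisF) Ec mulmxA.
Qed.

End Coordinates.

Section Curve.
Variables (k : closedFieldType) (V : vectType k).
Local Notation N := (\dim {:V}).
Local Notation B := (vbasis {:V}).
Implicit Types (U W : {vspace V}) (s : 'End(V)).

(** The line joining the identity (at [t = 0]) to [s] (at [t = 1]) in [End(V)].
    The endomorphisms that stabilise a given flag form a linear subspace, so the
    line stays among them when [s] does; only invertibility can fail, and it
    fails for finitely many [t]. *)
Definition curve s (t : k) : 'End(V) := \1%VF + t *: (s - \1%VF).

Lemma curve0 s : curve s 0 = \1%VF.
Proof. by rewrite /curve scale0r addr0. Qed.

Lemma curve1 s : curve s 1 = s.
Proof. by rewrite /curve scale1r addrC subrK. Qed.

Lemma curve_stab s t U : (s @: U <= U)%VS -> (curve s t @: U <= U)%VS.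
Proof.
move=> sU; apply/subvP=> _ /memv_imgP[u Uu ->].
rewrite add_lfunE scale_lfunE add_lfunE opp_lfunE id_lfunE.
by rewrite memvD ?memvZ ?memvB // (subvP sU) // memv_img.
Qed.

Definition curve_mx s : 'M[{poly k}]_N :=
  1%:M + 'X *: map_mx polyC (mxof B B s - 1%:M).

Lemma curve_mxE s t : map_mx (horner_eval t) (curve_mx s) = mxof B B (curve s t).
Proof.
rewrite /curve linearD linearZ linearB /=.
rewrite mxof1 ?(basis_free (vbasisF _)) //.
rewrite map_mxD map_mx1 map_mxZ; congr (_ + _).
apply/matrixP=> i j; rewrite 3!mxE [in RHS]mxE /= /horner_eval.
by rewrite hornerX hornerC.
Qed.

Lemma generically_dimD s t0 U W :
  generically (fun t =>
    (\dim (U + curve s t0 @: W) <= \dim (U + curve s t @: W))%N).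
Proof.
pose A := col_mx (map_mx polyC (basis_mx U)) (map_mx polyC (basis_mx W) *m curve_mx s).
have rkA t : \rank (map_mx (horner_eval t) A) = \dim (U + curve s t @: W).
  rewrite map_col_mx map_mxM curve_mxE !horner_eval_polyC.
  rewrite -addsmxE -[RHS]rank_basis_mx; apply/eqmx_rank/eqmxP/eqmx_sym.
  apply: (eqmx_trans (basis_mxD _ _)).
  exact: adds_eqmx (eqmx_refl _) (basis_mx_img _ _).
by apply: generically_imp (generically_rank A t0) => t; rewrite !rkA.
Qed.

Lemma generically_inj s : generically (fun t => lker (curve s t) == 0%VS).
Proof.
apply: generically_imp (generically_dimD s 0 0%VS {:V}) => t.
rewrite !add0v curve0 lim1g -(limg_ker_dim (curve s t) {:V}) capfv.
by rewrite -{2}[\dim (_ @: _)]add0n leq_add2r leqn0 dimv_eq0.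
Qed.

Lemma dim_img_inj s U : lker s == 0%VS -> \dim (s @: U) = \dim U.
Proof. by move=> /eqP s0; rewrite limg_dim_eq // s0 capv0. Qed.

(** Dually to the sum, the dimension of an intersection can only drop at a
    general point of the curve: the dimension of [curve s t @: W] is constant. *)
Lemma generically_dimI s t0 U W : lker (curve s t0) == 0%VS ->
  generically (fun t =>
    (\dim (U :&: curve s t @: W) <= \dim (U :&: curve s t0 @: W))%N).
Proof.
move=> inj0.
apply: generically_imp (generically_and (generically_inj s)
                          (generically_dimD s t0 U W)) => t [injt le].
have := dimv_sum_cap U (curve s t @: W); have := dimv_sum_cap U (curve s t0 @: W).
rewrite !dim_img_inj // => <- E; rewrite -(leq_add2l (\dim (U + curve s t @: W))).
by rewrite E leq_add2r.
Qed.

End Curve.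

(** * Relative position of two filtrations *)

Section Extension.
Variables (k : fieldType) (V : vectType k).
Implicit Types (g h : 'End(V)) (X Y C : {vspace V}).

Lemma dim_img_eq g X Y :
  (X <= Y)%VS -> \dim (g @: Y) = \dim Y -> \dim (g @: X) = \dim X.
Proof.
move=> XY dimY; apply: limg_dim_eq; apply/eqP; rewrite -subv0.
apply: subv_trans (capvS XY (subvv _)) _; rewrite subv0 -dimv_eq0.
by have := limg_ker_dim g Y; rewrite dimY -[RHS]add0n => /addIn->.
Qed.

Lemma lfun_onto C C' : \dim C = \dim C' -> exists g, (g @: C)%VS = C'.
Proof.
move=> dimC.
have [f fE] := linear_of_free (vbasis C) (vbasis C').
exists (linfun f); rewrite -{1}(span_basis (vbasisP C)) limg_span.
have -> : map (linfun f) (vbasis C) = map f (vbasis C).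
  by apply: eq_map => v; rewrite lfunE.
by rewrite fE ?(basis_free (vbasisP _)) ?size_tuple // (span_basis (vbasisP C')).
Qed.

(** [g] is changed only on a complement of [X :&: Y] in [Y], which is sent onto a
    complement of the image of [X :&: Y] in [Y']; the two complements have the
    same dimension.  Injectivity on [X + Y] follows by counting dimensions. *)
Lemma extend_iso g X Y Y' :
    \dim (g @: X) = \dim X -> (g @: (X :&: Y) = (g @: X) :&: Y')%VS ->
    \dim Y = \dim Y' ->
  exists h, [/\ {in X, h =1 g}, \dim (h @: (X + Y)) = \dim (X + Y)
              & (h @: Y)%VS = Y'].
Proof.
set X' := (g @: X)%VS => dimX imXY dimY.
have dimXY : \dim (X' :&: Y') = \dim (X :&: Y).
  by rewrite -imXY (dim_img_eq (capvSl X Y)).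
have [f fC] : exists f, (f @: (Y :\: X))%VS = (Y' :\: X')%VS.
  apply: lfun_onto; apply/eqP; rewrite -(eqn_add2l (\dim (Y :&: X))) dimv_cap_compl.
  by rewrite capvC -dimXY capvC dimv_cap_compl dimY.
pose h := ((g \o addv_pi2 Y X) + (f \o addv_pi1 Y X))%VF.
have hX : {in X, h =1 g}.
  move=> x Xx; rewrite /h add_lfunE !comp_lfunE addv_pi2_id //.
  have := addv_pi1_pi2 (subvP (addvSr Y X) x Xx).
  rewrite addv_pi2_id // -[RHS]add0r => /addIr ->.
  by rewrite linear0 addr0.
have hC : {in (Y :\: X)%VS, h =1 f}.
  move=> c Cc; rewrite /h add_lfunE !comp_lfunE.
  have Yc : c \in (Y + X)%VS.
    by rewrite (subvP (addvSl _ _)) // (subvP (diffvSl _ _) c Cc).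
  have := addv_pi1_pi2 Yc.
  rewrite /addv_pi1 daddv_pi_id ?capv_diff // -[RHS]addr0 => /addrI ->.
  by rewrite linear0 add0r.
have hY : (h @: Y)%VS = Y'.
  rewrite -{1}(addv_diff_cap Y X) limgD (eq_in_limg hC) fC.
  rewrite (@eq_in_limg _ _ _ _ h g); last first.
    by move=> v; rewrite memv_cap => /andP[_ /hX].
  by rewrite capvC imXY capvC addv_diff_cap.
exists h; split=> //.
rewrite limgD hY (eq_in_limg hX) -/X'.
apply/eqP; rewrite -(eqn_add2r (\dim (X :&: Y))) dimv_sum_cap.
by rewrite -dimXY dimv_sum_cap dimX dimY.
Qed.

Definition filtration (F : nat -> {vspace V}) n :=
  [/\ F 0%N = 0%VS, forall i, (F i <= F i.+1)%VS
    & forall i, (n <= i)%N -> F i = fullv].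

Lemma filtrationS F n i j : filtration F n -> (i <= j)%N -> (F i <= F j)%VS.
Proof.
move=> [_ Fm _]; move: i j.
apply: (@homo_leq _ F (fun U W => (U <= W)%VS)) => //.
by move=> W U Z; apply: subv_trans. Qed.

(** The relative position of two filtrations is determined by the dimensions of
    the intersections.  The isomorphism is built along the refinement
    [F i + (F i.+1 :&: G j)] of the first filtration by the second one, one
    application of [extend_iso] for each [j]; the modular law identifies the
    intersection of this subspace with the next [F i.+1 :&: G j.+1]. *)
Lemma filtrations_conj n (F G F' G' : nat -> {vspace V}) :
    filtration F n -> filtration G n -> filtration F' n -> filtration G' n ->
    (forall i j, \dim (F i :&: G j) = \dim (F' i :&: G' j)) ->
  exists g, [/\ lker g == 0%VS, forall i, F' i = (g @: F i)%VS
              & forall j, G' j = (g @: G j)%VS].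
Proof.
move=> fF fG fF' fG' dims.
have [[F0 _ Fn] [G0 _ Gn] [F'0 _ F'n] [G'0 _ G'n]] := And4 fF fG fF' fG'.
have modl (A C D E : {vspace V}) : (A <= C)%VS -> (D <= E)%VS ->
    ((A + (C :&: D)) :&: (C :&: E) = (A :&: E) + (C :&: D))%VS.
  move=> AC DE; rewrite capvC -[LHS]vspace_modr ?capvS //.
  by rewrite -capvA [(E :&: A)%VS]capvC capvA (capv_idPr AC).
have ind i : exists g, \dim (g @: F i) = \dim (F i) /\
   forall a b, (a <= i)%N -> (g @: (F a :&: G b) = F' a :&: G' b)%VS.
  elim: i => [|i [g [dimg gE]]].
    exists 0; split=> [|a b]; first by rewrite F0 limg0.
    by rewrite leqn0 => /eqP->; rewrite F0 F'0 !cap0v limg0.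
  (* Passing from [F i] to [F i.+1], through the subspaces [G j]. *)
  have indj j : exists h,
     [/\ \dim (h @: (F i + F i.+1 :&: G j)) = \dim (F i + F i.+1 :&: G j),
       forall a b, (a <= i)%N -> (h @: (F a :&: G b) = F' a :&: G' b)%VS
       & forall b, (b <= j)%N -> (h @: (F i.+1 :&: G b) = F' i.+1 :&: G' b)%VS].
    elim: j => [|j [h [dimh hE1 hE2]]].
      exists g; split=> // [|b]; first by rewrite G0 capv0 addv0.
      by rewrite leqn0 => /eqP->; rewrite G0 G'0 !capv0 limg0.
    have imX : (h @: (F i + F i.+1 :&: G j) = F' i + F' i.+1 :&: G' j)%VS.
      rewrite limgD hE2 //; congr (_ + _)%VS.
      by have := hE1 i n (leqnn i); rewrite Gn // G'n // !capvf.
    have imXY : (h @: ((F i + F i.+1 :&: G j) :&: (F i.+1 :&: G j.+1)) =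
                 (h @: (F i + F i.+1 :&: G j)) :&: (F' i.+1 :&: G' j.+1))%VS.
      rewrite imX !modl ?(filtrationS fF, filtrationS fG, filtrationS fF',
        filtrationS fG') //.
      by rewrite limgD hE1 // hE2.
    have [h' [h'h dimh' h'E]] := extend_iso dimh imXY (dims i.+1 j.+1).
    have sub_hE U : (U <= F i + F i.+1 :&: G j)%VS -> (h' @: U = h @: U)%VS.
      by move=> sU; apply: eq_in_limg => v /(subvP sU)/h'h.
    exists h'; split.
    - have sGj : (F i.+1 :&: G j <= F i.+1 :&: G j.+1)%VS.
        by rewrite capvS // (filtrationS fG).
      by move: dimh'; rewrite -addvA (addv_idPr sGj).
    - move=> a b le_ai; rewrite sub_hE ?hE1 //.
      apply: subv_trans (capvSl _ _) (subv_trans _ (addvSl _ _)).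
      exact: filtrationS fF le_ai.
    move=> b; rewrite leq_eqVlt => /orP[/eqP->//|lt_bj].
    rewrite sub_hE ?hE2 //; apply: subv_trans (addvSr _ _).
    by rewrite capvS // (filtrationS fG).
  have [h [dimh hE1 hE2]] := indj n.
  exists h; split.
    by move: dimh; rewrite Gn // capvf (addv_idPr (filtrationS fF (leqnSn i))).
  move=> a b; rewrite leq_eqVlt => /orP[/eqP->|]; last exact: hE1.
  case: (leqP b n) => [/hE2//|/ltnW le_nb].
  by have := hE2 n (leqnn n); rewrite !Gn ?G'n.
have [g [dimg gE]] := ind n; rewrite Fn // in dimg.
exists g; split.
- rewrite -dimv_eq0; have := limg_ker_dim g {:V}.
  by rewrite dimg capfv -[RHS]add0n => /addIn->.
- move=> i; case: (leqP i n) => [le_in|/ltnW le_ni].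
    by have := gE i n le_in; rewrite Gn // G'n // !capvf.
  by have := gE n n (leqnn n); rewrite !Fn ?F'n ?Gn ?G'n // !capvf.
- by move=> j; have := gE n j (leqnn n); rewrite Fn // F'n // !capfv.
Qed.
End Extension.

(** * Orbits of pairs of flags *)

Section FlagOrbits.
Variables (k : closedFieldType) (V : vectType k) (n : nat).
Local Notation flag := (flag V n).
Local Notation flag_pair := (flag_pair V n).
Local Notation orbit := (Defs.orbit V n).
Implicit Types (f : flag) (x y : flag_pair) (O : orbit) (g h : 'End(V)).

Lemma eq_flag f f' : (forall i, f i = f' i) -> f = f'.
Proof.
case: f f' => f fP [f' f'P] /= E; have {E} E: f = f' by apply/ffunP.
by rewrite E in fP *; rewrite (bool_irrelevance fP f'P).
Qed.

Lemma moves_fun g f f1 f2 : moves g f f1 -> moves g f f2 -> f1 = f2.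
Proof. by move=> E1 E2; apply: eq_flag => i; rewrite E1 E2. Qed.

Lemma moves1 f : moves \1%VF f f.
Proof. by move=> i; rewrite lim1g. Qed.

Lemma moves_comp g h f f' f'' :
  moves g f f' -> moves h f' f'' -> moves (h \o g)%VF f f''.
Proof. by move=> E E' i; rewrite limg_comp -E. Qed.

Lemma moves_inv g f f' : lker g == 0%VS -> moves g f f' -> moves (g^-1)%VF f' f.
Proof. by move=> g0 E i; rewrite E -limg_comp lker0_compVf // lim1g. Qed.

Lemma lker_comp g h :
  lker g == 0%VS -> lker h == 0%VS -> lker (h \o g)%VF == 0%VS.
Proof.
move=> /lker0P gI /lker0P hI; apply/lker0P => u v.
by rewrite !comp_lfunE => /hI/gI.
Qed.

Lemma lker_inv g : lker g == 0%VS -> lker (g^-1)%VF == 0%VS.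
Proof.
by move=> g0; apply/lker0P/(can_inj (g := g)) => v; rewrite lker0_lfunVK.
Qed.

Lemma lker1 : lker (\1%VF : 'End(V)) == 0%VS.
Proof. by apply/lker0P => u v; rewrite !id_lfunE. Qed.

Lemma moves_ex g f : lker g == 0%VS -> exists f', moves g f f'.
Proof.
move=> g0; have [f0 fn fm] := and3P (flagP f).
suff imP : is_flag [ffun i => (g @: f i)%VS].
  by exists (Flag imP) => i; rewrite ffunE.
apply/and3P; split; rewrite ?ffunE.
- by rewrite (eqP f0) limg0.
- by rewrite (eqP fn) lker0_limgf.
- by apply/forallP => i; rewrite !ffunE limgS // (forallP fm).
Qed.

Lemma same_orbit_refl x : same_orbit x x.
Proof. by exists \1%VF; split; [exact: lker1|exact: moves1|exact: moves1]. Qed.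

Lemma same_orbit_sym x y : same_orbit x y -> same_orbit y x.
Proof.
case=> g [g0 E1 E2]; exists g^-1%VF.
by split; [exact: lker_inv|exact: moves_inv|exact: moves_inv].
Qed.

Lemma same_orbit_trans x y z : same_orbit x y -> same_orbit y z -> same_orbit x z.
Proof.
case=> g [g0 E1 E2] [h [h0 E1' E2']]; exists (h \o g)%VF.
by split; [exact: lker_comp|apply: moves_comp E1'|apply: moves_comp E2'].
Qed.

(** These numbers carry the same information as the matrix attached to a pair of
    flags: each of the two arrays is obtained from the other by partial sums or
    differences. *)
Definition idim x i j := \dim (x.1 i :&: x.2 j).

(** Indexing by all natural numbers, constantly [fullv] from [n] on, spares the
    induction on filtrations any arithmetic of ordinals. *)
Definition flag_step f i : {vspace V} := f (inord (minn i n)).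

Lemma flag_stepE f (i : 'I_n.+1) : flag_step f i = f i.
Proof. by rewrite /flag_step (minn_idPl _) ?inord_val // -ltnS. Qed.

Lemma flag_filtration f : filtration (flag_step f) n.
Proof.
have [f0 fn fm] := and3P (flagP f).
split=> [|i|i le_ni].
- by rewrite -(eqP f0) -[0%N]/(val (@ord0 n)) flag_stepE.
- case: (ltnP i n) => [lt_in|le_ni]; last first.
    by rewrite /flag_step !(minn_idPr _) // ltnW.
  have := forallP fm (Ordinal lt_in); rewrite -!flag_stepE /=.
  by rewrite /bump /= add1n.
- rewrite /flag_step (minn_idPr le_ni) -(eqP fn).
  by congr (f _); apply: val_inj; rewrite /= inordK.
Qed.

(** In particular there are finitely many orbits, distinguished by integers that
    are semicontinuous: this is what makes a generic orbit exist. *)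
Lemma same_orbitP x y : same_orbit x y <-> forall i j, idim x i j = idim y i j.
Proof.
split=> [[g [g0 E1 E2]] i j|dims].
  by rewrite /idim E1 E2 -lker0_img_cap // dim_img_inj.
have [i j|g [g0 E1 E2]] :=
  filtrations_conj (flag_filtration x.1) (flag_filtration x.2)
                   (flag_filtration y.1) (flag_filtration y.2).
  exact: dims.
by exists g; split=> // i; rewrite -!flag_stepE.
Qed.

Fact orbit_of_proof x : `[< is_orbit [set y | same_orbit x y]%classic >].
Proof. by apply/asboolP; exists x. Qed.

Definition orbit_of x : orbit :=
  exist (fun X => is_true `[< is_orbit X >]) _ (orbit_of_proof x).

Lemma orbit_ofE O x : val O x -> O = orbit_of x.
Proof.
case: O => O /= /[dup] /asboolP[y ->] P /= yx; apply: val_inj => /=.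
apply/seteqP; split=> z /=; first exact: same_orbit_trans (same_orbit_sym yx).
exact: same_orbit_trans yx.
Qed.

Lemma orbit_of_ex O : exists x, O = orbit_of x.
Proof.
have /asboolP[x E] := valP O; exists x; apply: orbit_ofE.
by rewrite E; exact: same_orbit_refl.
Qed.

Lemma eq_orbit_of x y : same_orbit x y -> orbit_of x = orbit_of y.
Proof. by move=> xy; apply: orbit_ofE. Qed.

Lemma orbit_same O x y : val O x -> val O y <-> same_orbit x y.
Proof. by move=> /orbit_ofE->. Qed.

Lemma orbit_moves O g f1 f2 f1' f2' : lker g == 0%VS ->
  moves g f1 f1' -> moves g f2 f2' -> val O (f1, f2) -> val O (f1', f2').
Proof. by move=> g0 E1 E2 Of; apply/(orbit_same _ Of); exists g. Qed.

End FlagOrbits.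

(** * Composites in general position *)

Section Minimal.
Variables (k : closedFieldType) (V : vectType k) (n : nat).
Local Notation flag := (flag V n).
Local Notation flag_pair := (flag_pair V n).
Local Notation orbit := (Defs.orbit V n).
Implicit Types (f : flag) (x y : flag_pair) (O : orbit) (s g h : 'End(V)).
Implicit Types (S T : set flag_pair).

Lemma composites_orbit O O' x y :
  composites O O' x -> same_orbit x y -> composites O O' y.
Proof.
case: x y => x1 x2 [y1 y2] [f [Of O'f]] [g [g0 E1 E2]].
have [f' Ef] := moves_ex f g0; exists f'.
by split; [exact: (orbit_moves g0 E1 Ef Of)|exact: (orbit_moves g0 Ef E2 O'f)].
Qed.

(** Modulo [GL(V)], two points of [composites O O'] share their first flag and
    their middle flag [f]; their last flags then differ by an automorphism [s]
    that fixes [f].  The curve of [s] thus joins them inside [composites O O'],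
    which plays the role of irreducibility in all that follows. *)
Lemma composites_connected O O' f f1 f2 y :
    val O (f1, f) -> val O' (f, f2) -> composites O O' y ->
  exists s z, [/\ lker s == 0%VS, moves s f f, moves s f2 z & same_orbit (f1, z) y].
Proof.
move=> Of O'f; case: y => y1 y2 [f' [/= Of' O'f']].
have [g [g0 /= E1 E2]] := (orbit_same _ Of).1 Of'.
have [h [h0 /= E3 E4]] := (orbit_same _ O'f).1 O'f'.
have gV0 := lker_inv g0; have [z Ez] := moves_ex y2 gV0.
(* [g] and [h] both send [f] to [f'], so [g^-1 \o h] fixes [f]. *)
exists (g^-1 \o h)%VF, z; split.
- exact: lker_comp.
- exact: moves_comp E3 (moves_inv g0 E2).
- exact: moves_comp E4 Ez.
by exists g; split=> //= i; rewrite Ez -limg_comp lker0_compfV ?lim1g.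
Qed.

Lemma composites_moves O O' f f1 f2 f2' s : lker s == 0%VS -> moves s f f ->
  moves s f2 f2' -> val O (f1, f) -> val O' (f, f2) -> composites O O' (f1, f2').
Proof.
by move=> s0 Ef E2 Of O'f; exists f; split=> //; apply: orbit_moves s0 Ef E2 O'f.
Qed.

Lemma moves_curve s t f :
  lker (curve s t) == 0%VS -> moves s f f -> moves (curve s t) f f.
Proof.
move=> t0 Ef i; apply/eqP; rewrite eq_sym eqEdim dim_img_inj // leqnn andbT.
by rewrite curve_stab // -Ef.
Qed.

Lemma generically_idim s t0 f1 f2 f0 :
    lker (curve s t0) == 0%VS -> moves (curve s t0) f2 f0 ->
  generically (fun t => forall z, moves (curve s t) f2 z ->
    forall i j, (idim (f1, z) i j <= idim (f1, f0) i j)%N).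
Proof.
move=> inj0 E0.
have := generically_all (index_enum ('I_n.+1 * 'I_n.+1)%type)
  (fun p => generically_dimI (f1 p.1) (f2 p.2) inj0).
apply: generically_imp => t le z Ez i j.
by rewrite /idim /= Ez E0 (le (i, j)) ?mem_index_enum.
Qed.

Lemma generically_idim0 s f1 f2 :
  generically (fun t => forall z, moves (curve s t) f2 z ->
    forall i j, (idim (f1, z) i j <= idim (f1, f2) i j)%N).
Proof.
by apply: (@generically_idim s 0); rewrite curve0; [exact: lker1|exact: moves1].
Qed.

Lemma generically_idim1 s f1 f2 f0 : lker s == 0%VS -> moves s f2 f0 ->
  generically (fun t => forall z, moves (curve s t) f2 z ->
    forall i j, (idim (f1, z) i j <= idim (f1, f0) i j)%N).
Proof. by move=> s0 sf; apply: (@generically_idim s 1); rewrite curve1. Qed.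

(** A point whose two flags are in general position within [S].  For a set of
    composites, [minimal_open_orbit] and [open_orbit_minimal] show that the orbit
    of such points is the open one. *)
Definition minimal_in S x :=
  S x /\ forall y, S y -> forall i j, (idim x i j <= idim y i j)%N.

Lemma minimal_in_unique S x y : minimal_in S x -> minimal_in S y -> same_orbit x y.
Proof.
move=> [Sx mx] [Sy my]; apply/same_orbitP => i j; apply/eqP.
by rewrite eqn_leq mx ?my.
Qed.

Lemma minimal_in_le S m x : minimal_in S m -> S x ->
  (forall i j, (idim x i j <= idim m i j)%N) -> same_orbit m x.
Proof.
move=> [_ mm] Sx le; apply/same_orbitP => i j; apply/eqP.
by rewrite eqn_leq mm ?le.
Qed.

Lemma minimal_in_sub S T x : (forall z, S z -> T z) ->
    (forall y, T y -> exists2 z, S z & forall i j, (idim z i j <= idim y i j)%N) ->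
  minimal_in S x -> minimal_in T x.
Proof.
move=> ST TS [Sx mx]; split=> [|y Ty i j]; first exact: ST.
by have [z Sz le] := TS y Ty; apply: leq_trans (mx z Sz i j) (le i j).
Qed.

(** Each dimension is minimised at some point of [composites O O'].  These points
    are merged one index at a time: on a curve joining a point that is minimal
    for the indices already treated to one that is minimal for the next index,
    all these bounds hold at a general parameter. *)
Lemma minimal_ex O O' x :
  composites O O' x -> exists m, minimal_in (composites O O') m.
Proof.
set S := composites O O' => Sx.
suff [m Sm mm] : exists2 m, S m &
    forall p, p \in index_enum ('I_n.+1 * 'I_n.+1)%type ->
    forall y, S y -> (idim m p.1 p.2 <= idim y p.1 p.2)%N.
  by exists m; split=> // y Sy i j; apply: (mm (i, j)); rewrite ?mem_index_enum.
elim: (index_enum _) => [|[i j] r [m Sm mr]]; first by exists x.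
have /ex_minnP[d /asboolP[y Sy <-] dmin] :
    exists d, `[< exists2 y, S y & idim y i j = d >].
  by exists (idim x i j); apply/asboolP; exists x.
have [f [Of O'f]] := Sm.
have [s [z [s0 sf sz zy]]] := composites_connected Of O'f Sy.
have [t [t0 [le0 le1]]] := generically_ex (generically_and (generically_inj s)
  (generically_and (generically_idim0 s m.1 m.2) (generically_idim1 m.1 s0 sz))).
have [u Eu] := moves_ex m.2 t0; exists (m.1, u).
  exact: composites_moves (moves_curve t0 sf) Eu Of O'f.
move=> p; rewrite inE => /orP[/eqP->|pr] w Sw /=.
  apply: leq_trans (le1 u Eu i j) _; rewrite ((same_orbitP _ _).1 zy).
  by apply: dmin; apply/asboolP; exists w.
by apply: leq_trans (le0 u Eu _ _) _; rewrite -surjective_pairing mr.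
Qed.

(** The set of composites of three orbits, which does not depend on a
    bracketing. *)
Definition composites3 O1 O2 O3 : set flag_pair := [set x | exists f f',
  [/\ val O1 (x.1, f), val O2 (f, f') & val O3 (f', x.2)]]%classic.

(** Given a chain [(y1, f, f', y2)], the last two flags are moved along a curve in
    the stabiliser of [f] until [(y1, f')] becomes generic; the dimensions for
    [(y1, y2)] do not increase.  So restricting the composites of the first two
    orbits to their generic orbit loses no minimal value. *)
Lemma minimal_in_3l O1 O2 O3 m x : minimal_in (composites O1 O2) m ->
  minimal_in (composites (orbit_of m) O3) x -> minimal_in (composites3 O1 O2 O3) x.
Proof.
move=> mm; apply: minimal_in_sub => [z [f' [mz O3f']]|].
  by have [f [/= O1f O2f]] := composites_orbit mm.1 mz; exists f, f'.
move=> [y1 y2] [f [f' [/= O1f O2f O3f']]].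
have [s [z [s0 sf sz zm]]] := composites_connected O1f O2f mm.1.
have [t [t0 [le0 le1]]] := generically_ex (generically_and (generically_inj s)
  (generically_and (generically_idim0 s y1 y2) (generically_idim1 y1 s0 sz))).
have [u Eu] := moves_ex f' t0; have [w Ew] := moves_ex y2 t0.
exists (y1, w); last exact: le0.
exists u; split; last exact: orbit_moves t0 Eu Ew O3f'.
apply: minimal_in_le mm _ _ => [|i j].
  exact: composites_moves t0 (moves_curve t0 sf) Eu O1f O2f.
by rewrite -((same_orbitP _ _).1 zm); apply: le1.
Qed.

(** Here only the last flag moves, in the stabiliser of [f'], until [(f, y2)]
    becomes generic. *)
Lemma minimal_in_3r O1 O2 O3 m x : minimal_in (composites O2 O3) m ->
  minimal_in (composites O1 (orbit_of m)) x -> minimal_in (composites3 O1 O2 O3) x.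
Proof.
move=> mm; apply: minimal_in_sub => [z [f [O1f mz]]|].
  by have [f' [/= O2f O3f']] := composites_orbit mm.1 mz; exists f, f'.
move=> [y1 y2] [f [f' [/= O1f O2f O3f']]].
have [s [z [s0 sf sz zm]]] := composites_connected O2f O3f' mm.1.
have [t [t0 [le0 le1]]] := generically_ex (generically_and (generically_inj s)
  (generically_and (generically_idim0 s y1 y2) (generically_idim1 f s0 sz))).
have [w Ew] := moves_ex y2 t0.
exists (y1, w); last exact: le0.
exists f; split=> //; apply: minimal_in_le mm _ _ => [|i j].
  exact: composites_moves t0 (moves_curve t0 sf) Ew O2f O3f'.
by rewrite -((same_orbitP _ _).1 zm); apply: le1.
Qed.

Lemma minimal_ex3l O1 O2 O3 x : composites3 O1 O2 O3 x ->
  exists2 m, minimal_in (composites O1 O2) m &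
  exists y, minimal_in (composites (orbit_of m) O3) y.
Proof.
move=> [f [f' [O1f O2f O3f']]].
have [m mm] := @minimal_ex O1 O2 (x.1, f') (ex_intro _ f (conj O1f O2f)).
exists m => //.
have [s [z [s0 sf sz zm]]] := composites_connected O1f O2f mm.1.
have [w Ew] := moves_ex x.2 s0.
apply: (@minimal_ex _ _ (x.1, w)); exists z; split.
  exact: same_orbit_sym.
exact: orbit_moves s0 sz Ew O3f'.
Qed.

Lemma minimal_ex3r O1 O2 O3 x : composites3 O1 O2 O3 x ->
  exists2 m, minimal_in (composites O2 O3) m &
  exists y, minimal_in (composites O1 (orbit_of m)) y.
Proof.
move=> [f [f' [O1f O2f O3f']]].
have [m mm] := @minimal_ex O2 O3 (f, x.2) (ex_intro _ f' (conj O2f O3f')).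
exists m => //.
have [s [z [s0 sf sz zm]]] := composites_connected O2f O3f' mm.1.
apply: (@minimal_ex _ _ (x.1, z)); exists f; split=> //.
exact: same_orbit_sym.
Qed.

End Minimal.

(** * Maximal minors *)

Section Minors.
Variables (R : comNzRingType) (N : nat).
Implicit Types I : {set 'I_N}.

(** The increasing enumeration of [I], on an index type ['I_d] that need not be
    syntactically ['I_#|I|]. *)
Definition enum_cols d I (e : d = #|I|) (j : 'I_d) : 'I_N := enum_val (cast_ord e j).

Definition maxminor d (X : 'M[R]_(d, N)) I : R :=
  if d =P #|I| is ReflectT e then \det (colsub (enum_cols e) X) else 0.

Lemma maxminorE d (X : 'M[R]_(d, N)) I (e : d = #|I|) :
  maxminor X I = \det (colsub (enum_cols e) X).
Proof.
by rewrite /maxminor; case: eqP => // e'; rewrite (eq_irrelevance e' e).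
Qed.

Lemma maxminor_neq d (X : 'M[R]_(d, N)) I : d != #|I| -> maxminor X I = 0.
Proof. by rewrite /maxminor; case: eqP. Qed.

Lemma maxminor_mul d (M : 'M[R]_d) (X : 'M[R]_(d, N)) I :
  maxminor (M *m X) I = \det M * maxminor X I.
Proof.
case: (eqVneq d #|I|) => [e|ne]; last by rewrite !maxminor_neq ?mulr0.
by rewrite !(maxminorE _ e) -mulmx_colsub det_mulmx.
Qed.

(** The constant is the sign of the permutation that sorts [h], or [0] if [h] is
    not injective.  What matters is that it does not depend on [X]. *)
Lemma det_colsub_maxminor d (h : 'I_d -> 'I_N) : exists c : R,
  forall X : 'M[R]_(d, N), \det (colsub h X) = c * maxminor X [set h j | j : 'I_d].
Proof.
set I := [set h j | j : 'I_d].
have [e|ne] := eqVneq d #|I|.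
  exists (\det (\matrix_(l, j) (enum_cols e l == h j)%:R)) => X.
  rewrite (maxminorE _ e) mulrC -det_mulmx; congr (\det _).
  apply/matrixP => i j; rewrite !mxE.
  have Ihj : h j \in I by apply: imset_f.
  pose l0 := cast_ord (esym e) (enum_rank_in Ihj (h j)).
  have El0 : enum_cols e l0 = h j by rewrite /enum_cols cast_ordKV enum_rankK_in.
  rewrite (bigD1 l0) //= !mxE El0 eqxx mulr1 big1 ?addr0 // => l ne_l.
  rewrite !mxE -El0; case: eqP => [/enum_val_inj/cast_ord_inj El|_].
    by rewrite El eqxx in ne_l.
  by rewrite mulr0.
exists 0 => X; rewrite mul0r.
have /injectivePn[j1 [j2 ne12 h12]] : ~~ injectiveb h.
  apply: contra ne => /injectiveP hI; rewrite card_imset // card_ord.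
  exact: eqxx.
rewrite -det_tr (determinant_alternate ne12) // => i.
by rewrite !mxE h12.
Qed.

Definition replace_at d (h : 'I_d -> 'I_N) i j : 'I_d -> 'I_N :=
  fun l => if l == i then j else h l.

(** Cramer's rule: the entries of [\adj (colsub h X) *m X] are themselves maximal
    minors of [X]. *)
Lemma adj_colsub_mul d (h : 'I_d -> 'I_N) (X : 'M[R]_(d, N)) i j :
  (\adj (colsub h X) *m X) i j = \det (colsub (replace_at h i j) X).
Proof.
rewrite (expand_det_col _ i) mxE; apply: eq_bigr => l _.
rewrite !mxE /replace_at eqxx mulrC; congr (_ * (_ * \det _)).
by apply/matrixP => a b; rewrite !mxE eq_sym (negPf (neq_lift _ _)).
Qed.

End Minors.

Section MinorsField.
Variables (k : fieldType) (N : nat).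

Lemma colsub_unit d (X : 'M[k]_(d, N)) : \rank X = d ->
  exists h : 'I_d -> 'I_N, \det (colsub h X) != 0.
Proof.
move=> rX; have fX : row_full X^T by rewrite /row_full mxrank_tr rX.
exists (fullrankfun fX); rewrite -unitfE -det_tr -unitmxE.
have := fullrowsub_unit fX.
by rewrite trmx_mxsub.
Qed.

End MinorsField.

(** * Zariski topology and the open orbit *)

Section Pluecker.
Variables (k : closedFieldType) (V : vectType k) (n : nat).
Local Notation flag := (flag V n).
Local Notation flag_pair := (flag_pair V n).
Local Notation orbit := (Defs.orbit V n).
Local Notation N := (\dim {:V}).
Local Notation B := (vbasis {:V}).
Implicit Types (f : flag) (O : orbit) (s : 'End(V)).

Lemma pluckerE (U : {vspace V}) I : plucker U I = maxminor (basis_mx U) I.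
Proof.
rewrite /plucker eq_sym; case: eqP => [e|/eqP ne]; last by rewrite maxminor_neq.
rewrite (maxminorE _ e) /basis_mx.
suff E d (F : nat -> 'I_N -> k) (e' : d = #|I|) :
    \det (\matrix_(i < #|I|, j < #|I|) F i (enum_val j)) =
    \det (colsub (enum_cols e') (\matrix_(i, j) F i j)).
  exact: (E _ (fun i j => coord B j (vbasis U)`_i)).
subst d; congr (\det _); apply/matrixP => i j.
by rewrite !mxE /enum_cols cast_ord_id.
Qed.

(** Two bases of [U] have proportional vectors of maximal minors. *)
Lemma plucker_rows (U : {vspace V}) d (X : 'M[k]_(d, N)) :
    d = \dim U -> (X :=: basis_mx U)%MS ->
  exists2 l, l != 0 & forall I, plucker U I = l * maxminor X I.
Proof.
move=> e; subst d => XU.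
have /submxP[M E] : (basis_mx U <= X)%MS by rewrite XU.
exists (\det M); last by move=> I; rewrite pluckerE E maxminor_mul.
rewrite -unitfE -unitmxE -row_free_unit -row_leq_rank.
by rewrite -{1}(rank_basis_mx U) E mxrankM_maxl.
Qed.


(** Up to a common factor, the Pluecker coordinates of [curve s t @: U] are
    polynomials in [t].  At [t = 0] the factor is [1], because the basis of [U]
    used to define [plucker] is the one that the curve moves. *)
Lemma plucker_curve s (U : {vspace V}) :
  exists q : {set 'I_N} -> {poly k},
    (forall I, (q I).[0] = plucker U I) /\
    forall t, lker (curve s t) == 0%VS ->
      exists2 l, l != 0 & forall I, plucker (curve s t @: U) I = l * (q I).[t].
Proof.
pose A := map_mx polyC (basis_mx U) *m curve_mx s.
have ev (t : k) I : (maxminor A I).[t] = maxminor (basis_mx U *m mxof B B (curve s t)) I.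
  have [e|ne] := eqVneq (\dim U) #|I|; last by rewrite !maxminor_neq ?horner0.
  rewrite !(maxminorE _ e) -[LHS]/(horner_eval t _) -det_map_mx map_mxsub map_mxM.
  by rewrite curve_mxE horner_eval_polyC.
exists (maxminor A); split=> [I|t inj].
  by rewrite ev curve0 mxof1 ?(basis_free (vbasisF _)) // mulmx1 pluckerE.
have [|l l0 lE] := @plucker_rows (curve s t @: U) _
  (basis_mx U *m mxof B B (curve s t)) _ (eqmx_sym (basis_mx_img _ _)).
  by rewrite dim_img_inj.
by exists l => // I; rewrite ev.
Qed.

Definition point (c : factor n -> k) (x : flag_pair) : 'I_#|coord_index V n| -> k :=
  fun t => let aI : coord_index V n := enum_val t in
           c aI.1 * plucker (factor_space x aI.1) aI.2.

Lemma not_vanishes p x : ~ vanishes p x <->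
  exists2 c : factor n -> k, (forall a, c a != 0) & p.@[point c x] != 0.
Proof.
split=> [/existsNP[c /not_implyP[c0 /eqP pc]]|[c c0 /eqP pc] /(_ c c0)//].
by exists c.
Qed.

(** A polynomial that does not vanish at the starting point restricts to a nonzero
    polynomial in [t].  The factors of [plucker_curve] are absorbed in the choice
    of homogeneous coordinates. *)
Lemma generically_outside (Z : set flag_pair) s f1 f2 :
    zariski_closed Z -> ~ Z (f1, f2) ->
  generically (fun t => lker (curve s t) == 0%VS ->
    forall w, moves (curve s t) f2 w -> ~ Z (f1, w)).
Proof.
move=> [P ->] /= /existsNP[p /not_implyP[Pp /not_vanishes[c c0 pc]]].
have /choice[q qE] i := plucker_curve s (f2 i).
pose h (t : 'I_#|coord_index V n|) : {poly k} :=
  let aI : coord_index V n := enum_val t in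
  c aI.1 *: (if aI.1.1 then q aI.1.2 aI.2 else (plucker (f1 aI.1.2) aI.2)%:P).
have hE t : (mmap polyC h p).[t] = p.@[fun i => (h i).[t]].
  rewrite /meval /mmap /mmap1 horner_sum; apply: eq_bigr => m _.
  rewrite hornerM hornerC horner_prod; congr (_ * _); apply: eq_bigr => i _.
  by rewrite hornerE.
exists (mmap polyC h p).
  apply: contraNneq pc => h0; move: (hE 0); rewrite h0 horner0 => E.
  apply/eqP; rewrite [RHS]E; apply: meval_eq => i.
  rewrite /point /h /factor_space /= hornerZ.
  by case: (enum_val i) => [[[] a] I] /=; rewrite ?(qE a).1 ?hornerC.
move=> t; rewrite hE => pt inj w Ew Zw; apply: (not_vanishes p (f1, w)).2 (Zw p Pp).
have /choice[l lE] i : exists l, l != 0 /\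
    forall I, plucker (curve s t @: f2 i) I = l * (q i I).[t].
  by have [l l0 lE] := (qE i).2 t inj; exists l.
(* Rescaling by [l] replaces the basis chosen by [plucker] by the moving one. *)
exists (fun a => if a.1 then c a / l a.2 else c a).
  by move=> a; case: ifP => _ //; rewrite mulf_neq0 ?invr_eq0 //; case: (lE a.2).
move: pt; congr (_ != _); apply: meval_eq => i.
rewrite /point /h /factor_space /= hornerZ.
case: (enum_val i) => [[[] a] I] /=; last by rewrite hornerC.
by rewrite Ew (lE a).2 -mulrA mulKf ?(lE a).1.
Qed.


(** By Cramer's rule, [\adj (colsub h X) *m X] has Pluecker coordinates of the row
    space of [X] as entries, up to constants; its rows lie in that row space, and
    span it when [colsub h X] is invertible, which happens for some [h]. *)
Lemma spanning_polys (a : factor n) d :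
  exists M : {ffun 'I_d -> 'I_N} -> 'M[{mpoly k[#|coord_index V n|]}]_(d, N),
  forall (x : flag_pair) c, (forall b, c b != 0) -> \dim (factor_space x a) = d ->
    (forall h, (map_mx (meval (point c x)) (M h) <= basis_mx (factor_space x a))%MS) /\
    exists h, (map_mx (meval (point c x)) (M h) :=: basis_mx (factor_space x a))%MS.
Proof.
have /choice[sg sgE] (h : {ffun 'I_d -> 'I_N}) := @det_colsub_maxminor k N d h.
pose coordX I : {mpoly k[#|coord_index V n|]} :=
  'X_(enum_rank ((a, I) : coord_index V n)).
pose M (h : {ffun 'I_d -> 'I_N}) : 'M[{mpoly k[#|coord_index V n|]}]_(d, N) :=
  \matrix_(i, j) let h' := [ffun l => replace_at h i j l] in
     ((sg h')%:MP * coordX [set h' l | l : 'I_d]).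
exists M => x c c0 dimd; subst d.
set U := factor_space x a; set X := basis_mx U.
have ME h : map_mx (meval (point c x)) (M h) = c a *: (\adj (colsub h X) *m X).
  apply/matrixP => i j; rewrite 2!mxE [RHS]mxE adj_colsub_mul /=.
  rewrite mevalM mevalC mevalXU /point enum_rankK /= pluckerE mulrCA.
  rewrite -sgE; congr (_ * \det _).
  by apply/matrixP => l m; rewrite !mxE ffunE.
split=> [h|]; first by rewrite ME scalemx_sub // submxMl.
have [h hX] := colsub_unit (rank_basis_mx U).
(* For invertible [colsub h X], the adjugate identity recovers [X] from
   [\adj (colsub h X) *m X]. *)
exists [ffun l => h l]; apply/eqmxP/andP; rewrite ME; split.
  by rewrite scalemx_sub // submxMl.
have -> : colsub [ffun l => h l] X = colsub h X.
  by apply/matrixP => i j; rewrite !mxE ffunE.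
have E : (c a * \det (colsub h X)) *: X =
    colsub h X *m (c a *: (\adj (colsub h X) *m X)).
  by rewrite -scalemxAr mulmxA mul_mx_adj mul_scalar_mx scalerA.
by rewrite -(eqmx_scale X (mulf_neq0 (c0 a) hX)) E submxMl.
Qed.

(** On pairs of subspaces of fixed dimensions, a lower bound on the dimension of
    the sum is an open condition: it is the nonvanishing of some minor of the
    matrices of [spanning_polys] put on top of each other.  The equivalence holds
    for every fixed choice [c] of homogeneous coordinates, so that several such
    conditions can be combined by multiplying the polynomials. *)
Lemma dim_polys i j d e q : exists P : set {mpoly k[#|coord_index V n|]},
  forall (x : flag_pair) c, (forall a, c a != 0) ->
    \dim (x.1 i) = d -> \dim (x.2 j) = e ->
  (exists2 p, P p & p.@[point c x] != 0) <-> (q <= \dim (x.1 i + x.2 j))%N.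
Proof.
have [M1 M1E] := spanning_polys (false, i) d.
have [M2 M2E] := spanning_polys (true, j) e.
pose D h1 h2 (L : 'M[k]_(q, d + e)) (R : 'M[k]_(N, q)) :=
  \det (map_mx (@mpolyC _ k) L *m col_mx (M1 h1) (M2 h2) *m map_mx (@mpolyC _ k) R).
exists [set p | exists h1 h2 L R, p = D h1 h2 L R]%classic => x c c0 dimi dimj.
have {M1E} [le1 [h1 eq1]] := M1E x c c0 dimi.
have {M2E} [le2 [h2 eq2]] := M2E x c c0 dimj.
have DE g1 g2 L R : (D g1 g2 L R).@[point c x] =
   \det (L *m col_mx (map_mx (meval (point c x)) (M1 g1))
                     (map_mx (meval (point c x)) (M2 g2)) *m R).
  rewrite -det_map_mx !map_mxM map_col_mx -!map_mx_comp.
  by congr (\det (_ *m _ *m _)); apply/matrixP => a b; rewrite !mxE /= mevalC.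
have sumE : \rank (basis_mx (x.1 i) + basis_mx (x.2 j))%MS = \dim (x.1 i + x.2 j).
  by rewrite -[RHS]rank_basis_mx; apply/eqmx_rank/eqmxP/eqmx_sym/basis_mxD.
rewrite -sumE; split=> [[_ [g1 [g2 [L [R ->]]]]]|].
  rewrite DE => LR.
  have := introT (rank_minorP q _) (ex_intro _ L (ex_intro _ R LR)).
  by move=> /leq_trans; apply; rewrite mxrankS // -addsmxE addsmxS.
move=> le_q.
have /rank_minorP[L [R LR]] : (q <= \rank (col_mx (map_mx (meval (point c x)) (M1 h1))
                     (map_mx (meval (point c x)) (M2 h2))))%N.
  by rewrite -addsmxE (adds_eqmx eq1 eq2).
by exists (D h1 h2 L R); [exists h1, h2, L, R|rewrite DE].
Qed.

Lemma composites_dim O O' x y : composites O O' x -> composites O O' y ->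
  forall i, \dim (x.1 i) = \dim (y.1 i) /\ \dim (x.2 i) = \dim (y.2 i).
Proof.
move=> [f [Of O'f]] [f' [Of' O'f']] i.
have [g [g0 /= E1 E2]] := (orbit_same _ Of).1 Of'.
have [h [h0 /= E3 E4]] := (orbit_same _ O'f).1 O'f'.
by rewrite E1 E4 !dim_img_inj.
Qed.

(** Within [composites O O'], where the dimensions of the steps are fixed, the
    orbit of [m] is defined by the finitely many open conditions
    [\dim (m.1 i + m.2 j) <= \dim (x.1 i + x.2 j)]. *)
Lemma minimal_open_orbit O O' m :
  minimal_in (composites O O') m -> is_open_orbit (composites O O') (orbit_of m).
Proof.
move=> mm; set S := composites O O'; split.
  by move=> x; apply: composites_orbit mm.1.
have /choice[P PE] (ij : 'I_n.+1 * 'I_n.+1) := dim_polys ij.1 ij.2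
  (\dim (m.1 ij.1)) (\dim (m.2 ij.2)) (\dim (m.1 ij.1 + m.2 ij.2)).
pose Q : set {mpoly k[#|coord_index V n|]} := [set p | exists2 F,
  (forall ij, P ij (F ij)) & p = \prod_ij F ij]%classic.
exists [set x | forall p, Q p -> vanishes p x]%classic; first by exists Q.
have idimE x i j : S x ->
    (\dim (m.1 i + m.2 j) <= \dim (x.1 i + x.2 j))%N = (idim x i j <= idim m i j)%N.
  move=> Sx; have [d1 _] := composites_dim Sx mm.1 i.
  have [_ d2] := composites_dim Sx mm.1 j.
  rewrite -(leq_add2r (\dim (x.1 i :&: x.2 j))) dimv_sum_cap d1 d2.
  by rewrite -(dimv_sum_cap (m.1 i)) leq_add2l.
apply/seteqP; split=> x.
  move=> /= mx; have Sx : S x by apply: composites_orbit mm.1 mx.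
  split=> // Zx.
  have c0 a : (fun _ : factor n => 1 : k) a != 0 by rewrite oner_neq0.
  have /choice[F FE] ij : exists p, P ij p /\ p.@[point (fun=> 1) x] != 0.
    have [d1 _] := composites_dim Sx mm.1 ij.1.
    have [_ d2] := composites_dim Sx mm.1 ij.2.
    have [|p Pp px] := (PE ij x _ c0 d1 d2).2; last by exists p.
    by rewrite idimE // ((same_orbitP _ _).1 mx).
  have QF : Q (\prod_ij F ij) by exists F => // ij; case: (FE ij).
  apply: (not_vanishes _ x).2 (Zx _ QF); exists (fun=> 1) => //.
  by rewrite rmorph_prod; apply/prodf_neq0 => ij _; case: (FE ij).
move=> [Sx] /existsNP[p /not_implyP[[F FP ->] /not_vanishes[c c0 px]]].
apply: (minimal_in_le mm Sx) => i j; rewrite -idimE //.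
have [d1 _] := composites_dim Sx mm.1 i; have [_ d2] := composites_dim Sx mm.1 j.
apply: (PE (i, j) x c c0 d1 d2).1; exists (F (i, j)); first exact: FP.
by move: px; rewrite rmorph_prod => /prodf_neq0; apply.
Qed.

(** The curve from [y] to a minimal point stays outside the closed complement of
    the orbit of [y] for general [t], and consists of minimal points for general
    [t]: the two orbits meet. *)
Lemma open_orbit_minimal O O' x y : minimal_in (composites O O') x ->
  is_open_orbit (composites O O') (orbit_of y) -> orbit_of y = orbit_of x.
Proof.
move=> mx [yS [Z Zc yE]].
have yy : val (orbit_of y) y by apply: same_orbit_refl.
have Sy : composites O O' y := yS _ yy.
have nZy : ~ Z (y.1, y.2).
  by move: yy; rewrite yE -surjective_pairing => -[].
have [f [Of O'f]] := Sy.
have [s [z [s0 sf sz zx]]] := composites_connected Of O'f mx.1.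
have [t [t0 [le1 out]]] := generically_ex (generically_and (generically_inj s)
  (generically_and (generically_idim1 y.1 s0 sz) (generically_outside s Zc nZy))).
have [w Ew] := moves_ex y.2 t0.
have Sw : composites O O' (y.1, w).
  exact: composites_moves t0 (moves_curve t0 sf) Ew Of O'f.
have : val (orbit_of y) (y.1, w) by rewrite yE; split=> //; exact: out t0 w Ew.
move=> yw; apply: eq_orbit_of; apply: same_orbit_trans yw _; apply: same_orbit_sym.
apply: (minimal_in_le mx Sw) => i j.
by rewrite -((same_orbitP _ _).1 zx); apply: le1.
Qed.

End Pluecker.

(** * Linear maps on a free abelian group *)

Section FreeModule.
Variables (K : choiceType) (M : lmodType int).
Local Notation freeZ := {freeg K / int}.

Lemma additive_linear (A : lmodType int) (F : A -> M) : additive F -> linear F.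
Proof.
move=> addF; have F0 : F 0 = 0 by rewrite -[0 in LHS](subrr 0) addF subrr.
have FN u : F (- u) = - F u by rewrite -[- u]add0r addF F0 add0r.
have FD u v : F (u + v) = F u + F v by rewrite -[v in LHS]opprK addF FN opprK.
move=> a u v; rewrite FD; congr (_ + _).
have Fn m : F (u *+ m) = F u *+ m.
  by elim: m => [|m IH]; rewrite ?mulr0n // !mulrS FD IH.
rewrite -[a]intz !scaler_int; case: a => m; first exact: Fn.
by rewrite NegzE !mulrNz FN; congr (- _); apply: Fn.
Qed.

Lemma fglift_linear (f : K -> M) : linear (fglift f : freeZ -> M).
Proof. exact/additive_linear/lift_is_additive. Qed.

Lemma freeg_linear_ext (F F' : freeZ -> M) :
  linear F -> linear F' -> (forall O, F << O >> = F' << O >>) -> F =1 F'.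
Proof.
move=> linF linF' E D.
have lin0 (H : freeZ -> M) : linear H -> H 0 = 0.
  by move=> linH; rewrite -[0 in LHS](subrr 0) -scaleN1r addrC linH scaleN1r addNr.
elim/freeg_ind_dom0: D => [|a O D _ _ IH]; first by rewrite !lin0.
have -> : << a *g O >> = a *: << O >> :> freeZ.
  by apply/eqP/freeg_eqP => O'; rewrite coeffZ !coeffU mul1r.
by rewrite linF linF' E IH.
Qed.

End FreeModule.

(** * The product *)

Section Algebra.
Variables (k : closedFieldType) (V : vectType k) (n : nat).
Local Notation flag := (flag V n).
Local Notation flag_pair := (flag_pair V n).
Local Notation orbit := (Defs.orbit V n).
Local Notation G := (G V n).
Implicit Types (f : flag) (x y : flag_pair) (O : orbit) (u v w : G).

Lemma star_basis_minimal O O' m :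
  minimal_in (composites O O') m -> star_basis O O' = << orbit_of m >>.
Proof.
move=> mm; rewrite /star_basis; case: pselect => [h|[]]; last first.
  by exists (orbit_of m); apply: minimal_open_orbit.
case: (cid h) => O'' /=; have [y ->] := orbit_of_ex O'' => Oy.
by rewrite (open_orbit_minimal mm Oy).
Qed.

Lemma star_basis_empty O O' :
  (forall x, ~ composites O O' x) -> star_basis O O' = 0.
Proof.
move=> S0; rewrite /star_basis; case: pselect => // h.
have [O'' [OS _]] := h; have [y Oy] := orbit_of_ex O''.
by case: (S0 y); apply: OS; rewrite Oy; apply: same_orbit_refl.
Qed.

Lemma star_linearl w : linear (fun u => star u w).
Proof. exact: fglift_linear. Qed.

Lemma starU a O w : star << a *g O >> w = a *: fglift (fun O' => star_basis O O') w.
Proof. exact: liftU. Qed.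

Lemma starUU O O' : star << O >> << O' >> = star_basis O O'.
Proof. by rewrite starU scale1r liftU scale1r. Qed.

Lemma star_linearr u : linear (star u).
Proof.
move=> a v w; pose F z := star z (a *: v + w).
pose F' z := a *: star z v + star z w.
rewrite -[LHS]/(F u) -[RHS]/(F' u); apply: freeg_linear_ext => [b z z'|b z z'|O].
- exact: star_linearl.
- rewrite /F' !star_linearl !scalerDr !scalerA [b * a]mulrC.
  by rewrite addrACA.
- by rewrite /F /F' !starU !scale1r fglift_linear.
Qed.

Lemma star0l w : star 0 w = 0.
Proof.
by rewrite -[0 in LHS](subrr 0) -scaleN1r addrC star_linearl scaleN1r addNr.
Qed.

Lemma star0r w : star w 0 = 0.
Proof.
by rewrite -[0 in LHS](subrr 0) -scaleN1r addrC star_linearr scaleN1r addNr.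
Qed.

(** Both brackets are the orbit of the minimal points of [composites3 O1 O2 O3] if
    this set is non-empty, and [0] otherwise. *)
Lemma star_basisA O1 O2 O3 :
  star << O1 >> (star_basis O2 O3) = star (star_basis O1 O2) << O3 >>.
Proof.
have [[x Sx]|/forallNP S0] := pselect (exists x, composites3 O1 O2 O3 x).
  have [m mm [y my]] := minimal_ex3l Sx.
  have [m' mm' [y' my']] := minimal_ex3r Sx.
  rewrite (star_basis_minimal mm) (star_basis_minimal mm') !starUU.
  rewrite (star_basis_minimal my) (star_basis_minimal my'); congr << _ >>.
  apply/eq_orbit_of/minimal_in_unique; first exact: minimal_in_3r mm' my'.
  exact: minimal_in_3l mm my.
transitivity (0 : G).
  have [[x Sx]|/forallNP S'0] := pselect (exists x, composites O2 O3 x).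
    have [m mm] := minimal_ex Sx.
    rewrite (star_basis_minimal mm) starUU.
    apply: star_basis_empty => z Sz; have [y my] := minimal_ex Sz.
    exact: (S0 y (minimal_in_3r mm my).1).
  by rewrite star_basis_empty // star0r.
have [[x Sx]|/forallNP S'0] := pselect (exists x, composites O1 O2 x).
  have [m mm] := minimal_ex Sx.
  rewrite (star_basis_minimal mm) starUU.
  apply/esym/star_basis_empty => z Sz; have [y my] := minimal_ex Sz.
  exact: (S0 y (minimal_in_3l mm my).1).
by rewrite star_basis_empty // star0l.
Qed.

Lemma starA : associative (@star k V n).
Proof.
move=> u v w.
apply: (freeg_linear_ext (F := fun u => star u (star v w))
          (F' := fun u => star (star u v) w)) => [|a u1 u2|O1]; rewrite /=.
- exact: star_linearl.
- by rewrite !star_linearl.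
apply: (freeg_linear_ext (F := fun v => star << O1 >> (star v w))
          (F' := fun v => star (star << O1 >> v) w)) => [a v1 v2|a v1 v2|O2] /=.
- by rewrite star_linearl star_linearr.
- by rewrite star_linearr star_linearl.
apply: (freeg_linear_ext (F := fun w => star << O1 >> (star << O2 >> w))
          (F' := star (star << O1 >> << O2 >>))) => [a w1 w2|a w1 w2|O3] /=.
- by rewrite !star_linearr.
- by rewrite star_linearr.
by rewrite !starUU star_basisA.
Qed.

Definition flag_type f : {ffun 'I_n.+1 -> 'I_(\dim {:V}).+1} :=
  [ffun i => inord (\dim (f i))].

Lemma flag_typeE f f' :
  flag_type f = flag_type f' <-> forall i, \dim (f i) = \dim (f' i).
Proof.
split=> [E i|E]; last by apply/ffunP => i; rewrite !ffunE E.
have := congr1 (fun t : {ffun _ -> _} => val (t i)) E.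
by rewrite !ffunE /= !inordK ?ltnS ?dimvS ?subvf.
Qed.

Lemma flag_type_orbit x y : same_orbit x y ->
  flag_type x.1 = flag_type y.1 /\ flag_type x.2 = flag_type y.2.
Proof.
by case=> g [g0 E1 E2]; split; apply/flag_typeE => i; rewrite ?E1 ?E2 dim_img_inj.
Qed.

Lemma flag_type_diag f f' : flag_type f = flag_type f' -> same_orbit (f, f) (f', f').
Proof.
move=> /flag_typeE E; apply/same_orbitP => i j; rewrite /idim /=.
have le_f (h : flag) (a b : 'I_n.+1) : (a <= b)%N -> (h a <= h b)%VS.
  by rewrite -!flag_stepE; apply: filtrationS (flag_filtration h).
case: (leqP i j) => [|/ltnW] ij; first by rewrite !(capv_idPl _) ?le_f.
by rewrite !(capv_idPr _) ?le_f.
Qed.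

(** Composing with [(f, f)] forces the middle flag to equal the first one. *)
Lemma star_diagl f f1 f2 : flag_type f = flag_type f1 ->
  star_basis (orbit_of (f, f)) (orbit_of (f1, f2)) = << orbit_of (f1, f2) >>.
Proof.
move=> /flag_type_diag ff1; apply: star_basis_minimal.
split=> [|y [f' [[g [g0 E E']] /= f12]] i j].
  by exists f1; split; [exact: ff1|apply: same_orbit_refl].
have E1 : y.1 = f' by apply: moves_fun E E'.
by rewrite ((same_orbitP _ _).1 f12) [y]surjective_pairing E1.
Qed.

Lemma star_diagl0 f f1 f2 : flag_type f <> flag_type f1 ->
  star_basis (orbit_of (f, f)) (orbit_of (f1, f2)) = 0.
Proof.
move=> ne; apply: star_basis_empty => x [f' [Of Of']]; apply: ne.
by have [_ ->] := flag_type_orbit Of; have [-> _] := flag_type_orbit Of'.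
Qed.

Lemma star_diagr f f1 f2 : flag_type f = flag_type f2 ->
  star_basis (orbit_of (f1, f2)) (orbit_of (f, f)) = << orbit_of (f1, f2) >>.
Proof.
move=> /flag_type_diag ff2; apply: star_basis_minimal.
split=> [|y [f' [/= f12 [g [g0 E E']]]] i j].
  by exists f2; split; [apply: same_orbit_refl|exact: ff2].
have E1 : y.2 = f' by apply: moves_fun E' E.
by rewrite ((same_orbitP _ _).1 f12) [y]surjective_pairing E1.
Qed.

Lemma star_diagr0 f f1 f2 : flag_type f <> flag_type f2 ->
  star_basis (orbit_of (f1, f2)) (orbit_of (f, f)) = 0.
Proof.
move=> ne; apply: star_basis_empty => x [f' [Of Of']]; apply: ne.
by have [-> _] := flag_type_orbit Of'; have [_ ->] := flag_type_orbit Of.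
Qed.

(** The orbit of the pairs [(f, f)] with [f] of type [d], when some flag has this
    type: these are the idempotents of the algebra, and their sum is its unit. *)
Definition diag_orbit (d : {ffun 'I_n.+1 -> 'I_(\dim {:V}).+1}) : G :=
  if pselect (exists f, flag_type f = d) is left h
  then << orbit_of (projT1 (cid h), projT1 (cid h)) >> else 0.

Lemma star_diag_orbitl d f1 f2 : star (diag_orbit d) << orbit_of (f1, f2) >> =
  if d == flag_type f1 then << orbit_of (f1, f2) >> else 0.
Proof.
rewrite /diag_orbit; case: pselect => [h|h].
  case: (cid h) => f /= <-; rewrite starUU.
  by case: eqP => [/star_diagl|/star_diagl0] ->.
by rewrite star0l; case: eqP => // E; case: h; exists f1.
Qed.

Lemma star_diag_orbitr d f1 f2 : star << orbit_of (f1, f2) >> (diag_orbit d) =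
  if d == flag_type f2 then << orbit_of (f1, f2) >> else 0.
Proof.
rewrite /diag_orbit; case: pselect => [h|h].
  case: (cid h) => f /= <-; rewrite starUU.
  by case: eqP => [/star_diagr|/star_diagr0] ->.
by rewrite star0r; case: eqP => // E; case: h; exists f2.
Qed.

Lemma star_suml (I : finType) (F : I -> G) w :
  star (\sum_i F i) w = \sum_i star (F i) w.
Proof.
elim/big_rec2: _ => [|i u v _ <-]; first exact: star0l.
by rewrite -[F i in LHS]scale1r star_linearl scale1r.
Qed.

Lemma star_sumr (I : finType) (F : I -> G) w :
  star w (\sum_i F i) = \sum_i star w (F i).
Proof.
elim/big_rec2: _ => [|i u v _ <-]; first exact: star0r.
by rewrite -[F i in LHS]scale1r star_linearr scale1r.
Qed.

Definition star_one : G := \sum_d diag_orbit d.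

Lemma star1l : left_id star_one (@star k V n).
Proof.
apply: (freeg_linear_ext (F' := id)) => [||O] //; first exact: star_linearr.
have [[f1 f2] ->] := orbit_of_ex O; rewrite star_suml (bigD1 (flag_type f1)) //=.
rewrite star_diag_orbitl eqxx big1 ?addr0 // => d ne.
by rewrite star_diag_orbitl (negPf ne).
Qed.

Lemma star1r : right_id star_one (@star k V n).
Proof.
apply: (freeg_linear_ext (F := fun u => star u _) (F' := id)) => [||O] //.
  exact: star_linearl.
have [[f1 f2] ->] := orbit_of_ex O; rewrite star_sumr (bigD1 (flag_type f2)) //=.
rewrite star_diag_orbitr eqxx big1 ?addr0 // => d ne.
by rewrite star_diag_orbitr (negPf ne).
Qed.

End Algebra.

Theorem proposition6p3 (k : closedFieldType) (V : vectType k) (n r : nat)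
    (hn : (1 <= n)%N) (hr : (1 <= r)%N) (hV : \dim (fullv : {vspace V}) = r) :
  is_assoc_Zalgebra (@star k V n).
Proof.
split=> [a x y z|a x y z||].
- exact: star_linearl.
- exact: star_linearr.
- exact: starA.
- by exists (star_one V n); split; [exact: star1l|exact: star1r].
Qed.
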